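(* Let $l=7$, $r\in\{1,2,3\}$ and $a=[r]$. Then $p_{16,4}(1/a)$ and $p_{32,12}(1/a)$ are in $S$.
   Context: For an integer $i$, $[i]=\sum x^{n^2}\in\mathbb{Z}/2[[x]]$, summed over $n\in\mathbb{Z}$ with $n\equiv i\pmod 7$. $S$ is the subring of $\mathbb{Z}/2[[x]]$ generated over $\mathbb{Z}/2$ by $[1],[2],[3]$. $1/a$ is taken in the field $L$ of Laurent series over $\mathbb{Z}/2$. For $q$ a power of $2$ and $0\le j<q$, $p_{q,j}:L\to L$ is $\sum_n c_nx^n\mapsto\sum_{n\equiv j\pmod q}c_nx^n$. *)

(* Defs.v *)
From HB Require Import structures.
From mathcomp Require Import all_boot all_order all_algebra.
From mathcomp Require Import finmap mathcomp_extra boolp classical_sets functions.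
From mathcomp Require Import cardinality fsbigop.
From mathcomp Require Import zify.

Set Implicit Arguments.
Unset Strict Implicit.
Unset Printing Implicit Defensive.

Import Order.TTheory GRing.Theory Num.Theory.

Local Open Scope classical_set_scope.
Local Open Scope ring_scope.

Record laurent (F : fieldType) : Type := Laurent {
  coef :> int -> F;
  coef_bounded : exists N : int, forall n : int, n < N -> coef n = 0
}.

Section LaurentField.
Variable F : fieldType.
Implicit Types (f g h : laurent F) (u v w : nat -> F) (N M : int).

Lemma laurent_eqP f g : (forall n, f n = g n) -> f = g.
Proof.
case: f g => [f Hf] [g Hg] /= /funext fg; case: g / fg in Hg *.
by rewrite (Prop_irrelevance Hf Hg).
Qed.

HB.instance Definition _ := gen_eqMixin (laurent F).
HB.instance Definition _ := gen_choiceMixin (laurent F).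

Lemma lzero_bounded :
  exists N : int, forall n : int, n < N -> (fun _ : int => 0 : F) n = 0.
Proof. by exists 0. Qed.
Definition lzero : laurent F := Laurent lzero_bounded.

Lemma lopp_bounded f :
  exists N : int, forall n : int, n < N -> (fun k : int => - f k) n = 0.
Proof. by have [N fN] := coef_bounded f; exists N => n /fN /= ->; rewrite oppr0. Qed.
Definition lopp f : laurent F := Laurent (lopp_bounded f).

Lemma ladd_bounded f g :
  exists N : int, forall n : int, n < N -> (fun k : int => f k + g k) n = 0.
Proof.
have [N fN] := coef_bounded f; have [M gM] := coef_bounded g.
exists (Order.min N M) => n; rewrite lt_min => /andP[/fN /= -> /gM /= ->].
by rewrite addr0.
Qed.
Definition ladd f g : laurent F := Laurent (ladd_bounded f g).

Lemma laddA : associative ladd.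
Proof. by move=> f g h; apply: laurent_eqP => n /=; rewrite addrA. Qed.
Lemma laddC : commutative ladd.
Proof. by move=> f g; apply: laurent_eqP => n /=; rewrite addrC. Qed.
Lemma ladd0 : left_id lzero ladd.
Proof. by move=> f; apply: laurent_eqP => n /=; rewrite add0r. Qed.
Lemma laddN : left_inverse lzero lopp ladd.
Proof. by move=> f; apply: laurent_eqP => n /=; rewrite addNr. Qed.

HB.instance Definition _ :=
  GRing.isZmodule.Build (laurent F) laddA laddC ladd0 laddN.

Lemma lone_bounded :
  exists N : int, forall n : int, n < N -> (fun k : int => (k == 0)%:R : F) n = 0.
Proof. by exists 0 => n n0; rewrite lt_eqF. Qed.
Definition lone : laurent F := Laurent lone_bounded.

(* The sum has finite support, because both series are bounded below. *)
Definition lmul_coef (f g : int -> F) (n : int) : F :=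
  \sum_(i \in [set: int]) f i * g (n - i).

(* [shift_series N u] is [x^N * \sum_k u_k x^k]; every Laurent series has this
   form, which reduces the ring axioms to convolution of sequences. *)
Definition shift_series N u : int -> F :=
  fun n => if n < N then 0 else u (absz (n - N)).

Definition conv u v : nat -> F := fun k => \sum_(i < k.+1) u i * v (k - i)%N.

Lemma shift_seriesE (f : int -> F) N : (forall n, n < N -> f n = 0) ->
  f = shift_series N (fun k => f (N + k%:Z)).
Proof.
move=> fN; apply/funext => n; rewrite /shift_series.
by case: (ltP n N) => [/fN //|Nn]; congr f; lia.
Qed.

Lemma lmul_shift N M u v :
  lmul_coef (shift_series N u) (shift_series M v)
  = shift_series (N + M) (conv u v).
Proof.
apply/funext => n; rewrite /lmul_coef [RHS]/shift_series; case: (ltP n (N + M)) => nNM.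
  apply: fsbig1 => i _; rewrite /shift_series.
  case: (ltP i N) => [_|Ni]; first by rewrite mul0r.
  by rewrite ifT ?mulr0 //; lia.
rewrite (fsbigE [seq N + k%:Z | k <- iota 0 (absz (n - (N + M))%R).+1]).
- rewrite big_mkcond
    big_map -[X in iota _ X]subn0 -/(index_iota _ _) big_mkord /conv.
  apply: eq_bigr => -[k kK] _ /=; rewrite in_setT /shift_series ifF; last by lia.
  rewrite ifF; last by lia.
  by congr (u _ * v _); lia.
- by rewrite map_inj_uniq ?iota_uniq // => i j; lia.
- by [].
- move=> j _; move: (j : int) => {j} i ir; rewrite /shift_series; case: (ltP i N) => [_|Ni]; first by rewrite mul0r.
  case: (ltP (n - i) M) => [_|Mi]; first by rewrite mulr0.
  case/negP: ir; apply/mapP; exists (absz (i - N)); last by lia.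
  by rewrite mem_iota; lia.
Qed.

Let trunc m u : {poly F} := \poly_(i < m) u i.

Lemma conv_trunc m k u v : (k < m)%N -> conv u v k = (trunc m u * trunc m v)`_k.
Proof.
move=> km; rewrite coefM; apply: eq_bigr => i _.
by rewrite !coef_poly !ifT //; have := ltn_ord i; lia.
Qed.

Lemma convC : commutative conv.
Proof.
by move=> u v; apply/funext => n; rewrite !(@conv_trunc n.+1) // mulrC.
Qed.

Lemma convA : associative conv.
Proof.
move=> u v w; apply/funext => n; rewrite !(@conv_trunc n.+1) //.
have trM a b k : (k < n.+1)%N ->
    (trunc n.+1 (conv a b))`_k = (trunc n.+1 a * trunc n.+1 b)`_k.
  by move=> kn; rewrite coef_poly kn (@conv_trunc n.+1).
transitivity ((trunc n.+1 u * (trunc n.+1 v * trunc n.+1 w))`_n).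
  by rewrite !coefM; apply: eq_bigr => i _; rewrite trM // ltnS leq_subr.
by rewrite mulrA !coefM; apply: eq_bigr => i _; rewrite trM.
Qed.

Lemma lmul_bounded f g : exists N : int, forall n : int, n < N -> lmul_coef f g n = 0.
Proof.
have [N /shift_seriesE ->] := coef_bounded f.
have [M /shift_seriesE ->] := coef_bounded g.
by exists (N + M) => n nNM; rewrite lmul_shift /shift_series nNM.
Qed.
Definition lmul f g : laurent F := Laurent (lmul_bounded f g).

Lemma laurentE f : exists N u, coef f = shift_series N u.
Proof. by have [N /shift_seriesE ->] := coef_bounded f; exists N; eexists. Qed.

Lemma lmulA : associative lmul.
Proof.
move=> f g h; apply: laurent_eqP => n /=.
have [N [u ->]] := laurentE f; have [M [v ->]] := laurentE g.
by have [P [w ->]] := laurentE h; rewrite !lmul_shift convA addrA.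
Qed.

Lemma lmulC : commutative lmul.
Proof.
move=> f g; apply: laurent_eqP => n /=.
have [N [u ->]] := laurentE f; have [M [v ->]] := laurentE g.
by rewrite !lmul_shift convC addrC.
Qed.

Lemma lmul1 : left_id lone lmul.
Proof.
move=> f; apply: laurent_eqP => n /=; rewrite /lmul_coef.
rewrite (fsbigE [:: 0]) //=; first by rewrite big_mkcond big_seq1 in_setT eqxx mul1r subr0.
by move=> i _; rewrite inE => /negPf ->; rewrite mul0r.
Qed.

Lemma lmulDl : left_distributive lmul (@GRing.add (laurent F)).
Proof.
move=> f g h; apply: laurent_eqP => n /=.
have [N fN] := coef_bounded f; have [M gM] := coef_bounded g.
have [P [w ->]] := laurentE h; pose K := Order.min N M.
have fK k : k < K -> f k = 0 by rewrite lt_min => /andP[/fN].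
have gK k : k < K -> g k = 0 by rewrite lt_min => /andP[_ /gM].
have [u ->] : exists u, coef f = shift_series K u by eexists; exact: shift_seriesE fK.
have [v ->] : exists v, coef g = shift_series K v by eexists; exact: shift_seriesE gK.
transitivity (lmul_coef (shift_series K (fun k => u k + v k)) (shift_series P w) n).
  congr (lmul_coef _ _ n); apply/funext => k; rewrite /shift_series.
  by case: ifP; rewrite ?addr0.
rewrite !lmul_shift /shift_series; case: ifP => _; first by rewrite addr0.
by rewrite /conv -big_split; apply: eq_bigr => i _; rewrite mulrDl.
Qed.

Lemma lone_neq0 : lone != 0.
Proof.
by apply/eqP => /(congr1 (fun f : laurent F => f 0))/eqP; rewrite /= oner_eq0.
Qed.

HB.instance Definition _ :=
  GRing.Zmodule_isComNzRing.Build (laurent F) lmulA lmulC lmul1 lmulDl lone_neq0.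

Lemma conv_inv u : u 0%N != 0 -> exists v, forall k : nat, conv v u k = (k == 0%N)%:R.
Proof.
move=> u0.
pose next (s : seq F) : F :=
  ((size s == 0%N)%:R - \sum_(i < size s) s`_i * u (size s - i)%N) / u 0%N.
pose vs := fix vs n := if n is m.+1 then rcons (vs m) (next (vs m)) else [::].
have size_vs n : size (vs n) = n by elim: n => //= n IHn; rewrite size_rcons IHn.
have nth_vs n k : (k < n)%N -> (vs n)`_k = next (vs k).
  elim: n => // n IHn; rewrite ltnS leq_eqVlt => /predU1P[->|kn] /=.
    by rewrite nth_rcons size_vs ltnn eqxx.
  by rewrite nth_rcons size_vs kn IHn.
exists (fun k : nat => next (vs k)) => n; rewrite /conv big_ord_recr /= subnn.
rewrite {2}/next size_vs divfK //.
under [X in _ - X]eq_bigr do rewrite nth_vs //.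
by rewrite addrC subrK.
Qed.

Lemma lmul_inv_exists f : f != 0 -> exists g, g * f = 1.
Proof.
move=> f0; have [N fN] := coef_bounded f.
have [k fk] : exists k : nat, f (N + k%:Z) != 0.
  apply: contrapT => /forallNP fz; case/eqP: f0; apply: laurent_eqP => n /=.
  case: (ltP n N) => [/fN //|Nn]; have /negP := fz (absz (n - N)).
  by rewrite negbK (_ : N + _ = n) => [/eqP //|]; lia.
have exk : exists k : nat, f (N + k%:Z) != 0 by exists k.
have [m fm minm] := ex_minnP exk.
have fM n : n < N + m%:Z -> f n = 0.
  case: (ltP n N) => [/fN //|Nn nm]; apply/eqP; apply: contraT => fn.
  have /minm : f (N + (absz (n - N))%:Z) != 0 by rewrite (_ : N + _ = n) //; lia.
  by lia.
have [|v vu] := @conv_inv (fun i : nat => f (N + m%:Z + i%:Z)).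
  by rewrite addr0.
have gb : exists K : int, forall n, n < K -> shift_series (- (N + m%:Z)) v n = 0.
  by exists (- (N + m%:Z)) => n nK; rewrite /shift_series nK.
exists (Laurent gb); apply: laurent_eqP => n /=.
rewrite (shift_seriesE fM) lmul_shift addNr /shift_series subr0 vu.
by case: (ltP n 0) => n0; [rewrite lt_eqF|congr (_%:R); lia].
Qed.

Definition linv f : laurent F :=
  if pselect (exists g, g * f = 1) is left ex then projT1 (cid ex) else 0.

Lemma lmulVf f : f != 0 -> linv f * f = 1.
Proof.
move=> /lmul_inv_exists ex; rewrite /linv; case: pselect => // {}ex.
exact: projT2 (cid ex).
Qed.

Lemma linv0 : linv 0 = 0.
Proof.
rewrite /linv; case: pselect => // ex; exfalso; case: ex => g /eqP.
by rewrite mulr0 eq_sym oner_eq0.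
Qed.

HB.instance Definition _ := GRing.ComNzRing_isField.Build (laurent F) lmulVf linv0.

(** The operator [p_(q,j)], keeping the exponents congruent to [j] modulo [q]. *)
Lemma lproj_bounded (q j : nat) f :
  exists N : int, forall n : int, n < N ->
    (fun k : int => if (k == j%:Z %[mod q%:Z])%Z then f k else 0) n = 0.
Proof. by have [N fN] := coef_bounded f; exists N => n /fN /= ->; case: ifP. Qed.
Definition lproj (q j : nat) f : laurent F := Laurent (lproj_bounded q j f).

End LaurentField.

(** The coefficient of [x^m] in [theta l i] is the number, in Z/2, of the
    [n : int] with [n = i] mod [l] and [n^2 = m]. *)
Lemma theta_bounded (l : nat) (i : int) :
  exists N : int, forall m : int, m < N ->
    (fun k : int => \sum_(n \in [set n : int | (n = i %[mod l%:Z])%Z /\ n ^+ 2 = k])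
                      (1 : 'F_2)) m = 0.
Proof.
exists 0 => m m0 /=; rewrite [X in \sum_(_ \in X) _](_ : _ = set0) ?fsbig_set0 //.
by rewrite -subset0 => n /= [_ nm]; move: m0; rewrite -nm ltNge sqr_ge0.
Qed.
Definition theta (l : nat) (i : int) : laurent 'F_2 := Laurent (theta_bounded l i).

Definition generated_subring (R : pzRingType) (G : set R) : set R :=
  smallest [set A : set R | subring_closed [in A]] G.

(** Z/2[[x]] is viewed inside the field of Laurent series, where [1/a] lives.
    A subring contains 1, so it is automatically an algebra over Z/2. *)
Definition theta_ring : set (laurent 'F_2) :=
  generated_subring [set theta 7 1; theta 7 2; theta 7 3].

(* Main.v *)
(** Write [i] for theta 7 i, a = [i], b = [2i], c = [4i].  Splitting n = i mod 7
    by parity gives a = c^4 + x, b = a^4 + y, c = b^4 + z, where the exponents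
    of x, y, z are 1 mod 8.  The substitution (m, n) -> (m + n, m - n) in the
    series of [i]^2 [j]^2 gives xz = a^2 b^2 + b^4 c^4 and its two cyclic shifts.
    As squaring doubles exponents, a^4 and c^4 have exponents divisible by 4, and
    1/a = a^3/a^4 = (terms with exponents 1, 2, 3 mod 4) + (c^3/a)^4.  Hence
    p_(16,4)(1/a) and p_(32,12)(1/a) are the fourth powers of p_(4,1)(c^3/a) and
    p_(8,3)(c^3/a).  Expanding c^3/a = (x + c^4)^3 (z + b^4)^3 / a^4, and in the
    second case refining b^4 and c^4 modulo 8, expresses these two parts
    as fractions, and the three relations cancel their denominators. *)

From Stdlib Require Import Ring PArith.
Require Import Defs.
From mathcomp Require Import all_boot all_order all_algebra.
From mathcomp Require Import boolp classical_sets functions cardinality fsbigop.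
From mathcomp Require Import zify.

Set Implicit Arguments.
Unset Strict Implicit.
Unset Printing Implicit Defensive.

Import Order.TTheory GRing.Theory Num.Theory.

Local Open Scope classical_set_scope.
Local Open Scope ring_scope.

(** * Identities in characteristic 2 *)

Section CharacteristicTwo.
Variables (K : fieldType) (char2 : 2%N \in [pchar K]).

Let zero : K := 0.
Let one : K := 1.
Let add (u v : K) : K := u + v.
Let opp (u : K) : K := - u.
Let mul (u v : K) : K := u * v.
Let exp (u : K) (n : nat) : K := u ^+ n.

Let char2_ring_theory : ring_theory zero one add mul (fun u v => add u (opp v)) opp eq.
Proof.
split=> //; [exact: add0r|exact: addrC|exact: addrA|exact: mul1r
  |exact: mulrC|exact: mulrA|exact: mulrDl|exact: addrN].
Qed.

Let char2_morph : ring_morph zero one add mul (fun u v => add u (opp v)) opp eq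
  false true xorb andb xorb id Bool.eqb (fun e : bool => if e then one else zero).
Proof.
split=> //; rewrite /add /mul /opp /zero /one.
- by do 2 case; rewrite /= ?addr0 ?add0r ?(addrr_pchar2 char2).
- by do 2 case; rewrite /= ?(oppr_pchar2 char2) ?addr0 ?add0r ?(addrr_pchar2 char2).
- by do 2 case; rewrite /= ?mulr0 ?mulr1.
- by case; rewrite /= (oppr_pchar2 char2).
- by do 2 case.
Qed.

Let char2_power : power_theory one mul eq BinNat.N.to_nat exp.
Proof.
split=> u [//|p] /=; elim: p => [p IHp|p IHp|]; last exact: expr1.
- by rewrite Pos2Nat.inj_xI [RHS]/= -IHp /exp /mul exprS multE mul2n -addnn exprD.
- by rewrite Pos2Nat.inj_xO [RHS]/= -IHp /exp /mul multE mul2n -addnn exprD.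
Qed.

Ltac exponent t := match isnatcst t with
  | true => constr:(BinNat.N.of_nat t)
  | _ => constr:(InitialRing.NotConstant) end.
Ltac bit t := match t with
  | zero => constr:(false) | one => constr:(true) | _ => constr:(InitialRing.NotConstant) end.

(* Coefficients are normalized in [bool], read as Z/2, so that [ring] also
   proves identities that hold only in characteristic 2. *)
Add Ring K_char2 : char2_ring_theory
  (morphism char2_morph, constants [bit], power_tac char2_power [exponent]).

(* [ring] matches the operations syntactically, whereas the same operation of [K]
   occurs with different structure instances; naming it hides the instance. *)
Ltac ring2 :=
  repeat match goal with
  | |- context [@Algebra.add ?V ?u ?v] => change (@Algebra.add V u v) with (add u v)
  | |- context [@GRing.mul ?V ?u ?v] => change (@GRing.mul V u v) with (mul u v)
  | |- context [@GRing.exp ?V ?u ?v] => change (@GRing.exp V u v) with (exp u v)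
  | |- context [@Algebra.opp ?V ?u] => change (@Algebra.opp V u) with (opp u)
  | |- context [@Algebra.zero ?V] => change (@Algebra.zero V) with zero
  | |- context [GRing.one ?V] => change (GRing.one V) with one
  end;
  match goal with |- @eq _ ?l ?r => change (@eq K l r) end; ring.

(** * Splitting by grade and cancellation of denominators *)

Variables (a b c : K).
Hypothesis a0 : a != 0.
Let x := a + c ^+ 4.
Let y := b + a ^+ 4.
Let z := c + b ^+ 4.
Hypotheses (xz : x * z = a ^+ 2 * b ^+ 2 + b ^+ 4 * c ^+ 4)
  (xy : x * y = b ^+ 2 * c ^+ 2 + c ^+ 4 * a ^+ 4)
  (yz : y * z = c ^+ 2 * a ^+ 2 + a ^+ 4 * b ^+ 4).

(* "Grade" is the exponent of the series variable: in the application [x], [y]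
   and [z] have grade 1 mod 8 and 2^k-th powers have grade 0 mod 2^k. *)
Lemma invr_split_mod4 : a^-1 =
  (x ^+ 3 + x ^+ 2 * c ^+ 4 + x * (c ^+ 4) ^+ 2) * a^-1 ^+ 4 + (c ^+ 3 / a) ^+ 4.
Proof.
transitivity (a ^+ 3 * a^-1 ^+ 4); last by rewrite /x; ring2.
by rewrite (exprSr a^-1) [a ^+ 3 * _]mulrA -exprMn divff // expr1n mul1r.
Qed.

(** Write c^3/a = a^3 c^3/a^4 with a = x + c^4 and c = z + b^4. The monomials are sorted by their
    total degree in x and z modulo 4, so the four summands have grades 0, 1, 2, 3 mod 4. *)
Lemma cube_div_split_mod4 : c ^+ 3 / a =
  ((c ^+ 4) ^+ 3 * (b ^+ 4) ^+ 3 + x ^+ 3 * z * (b ^+ 4) ^+ 2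
    + x ^+ 2 * z ^+ 2 * c ^+ 4 * b ^+ 4 + x * z ^+ 3 * (c ^+ 4) ^+ 2) * a^-1 ^+ 4
  + (b ^+ 8 * c ^+ 8 + x ^+ 2 * z ^+ 2) * (x * b ^+ 4 + z * c ^+ 4) * a^-1 ^+ 4
  + (x ^+ 2 * c ^+ 4 * (b ^+ 4) ^+ 3 + x * z * (c ^+ 4) ^+ 2 * (b ^+ 4) ^+ 2
    + z ^+ 2 * (c ^+ 4) ^+ 3 * b ^+ 4 + x ^+ 3 * z ^+ 3) * a^-1 ^+ 4
  + (x * b ^+ 4 + z * c ^+ 4) ^+ 3 * a^-1 ^+ 4.
Proof.
transitivity (c ^+ 3 * (a ^+ 3 * a^-1 ^+ 4)).
  by rewrite (exprSr a^-1) [a ^+ 3 * _]mulrA -exprMn divff // expr1n mul1r.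
by rewrite /x /z; ring2.
Qed.

(** A fourth power controls grades only mod 4, so a^-4 is replaced by a^4 a^-8 with a^4 = c^16 +
    x^4. For E of grade 1 and F of grade 5 mod 8, the summands have grades 3 and 7. *)
Lemma grade3_split_mod8 (E F : K) : (E + F) ^+ 3 * a^-1 ^+ 4 =
  (E + F) ^+ 2 * (c ^+ 16 * E + x ^+ 4 * F) * a^-1 ^+ 8
  + (E + F) ^+ 2 * (c ^+ 16 * F + x ^+ 4 * E) * a^-1 ^+ 8.
Proof.
transitivity ((E + F) ^+ 3 * (a ^+ 4 * a^-1 ^+ 8)).
  by rewrite (exprD _ 4 4) [a ^+ 4 * _]mulrA -exprMn divff // expr1n mul1r.
by rewrite /x; ring2.
Qed.

Lemma exprD4 (u v : K) : (u + v) ^+ 4 = u ^+ 4 + v ^+ 4.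
Proof. by ring2. Qed.

(** The left side is a b^4 + c^5, which [xz] turns into a^2 b^2 + a c. The factor a later cancels
    part of a denominator. *)
Lemma grade1_mod4_factor :
  x * b ^+ 4 + z * c ^+ 4 = a * (a * b ^+ 2 + c).
Proof.
transitivity (a * (a * b ^+ 2 + c) + (x * z + (a ^+ 2 * b ^+ 2 + b ^+ 4 * c ^+ 4))).
  by rewrite /x /z; ring2.
by rewrite xz; ring2.
Qed.

(** Squaring [xz] gives b^8 c^8 + x^2 z^2 = a^4 b^4, which absorbs the whole denominator. *)
Lemma grade1_mod4_part :
  (b ^+ 8 * c ^+ 8 + x ^+ 2 * z ^+ 2) * (x * b ^+ 4 + z * c ^+ 4) * a^-1 ^+ 4
  = b ^+ 4 * (x * b ^+ 4 + z * c ^+ 4).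
Proof.
have -> : b ^+ 8 * c ^+ 8 + x ^+ 2 * z ^+ 2 = a ^+ 4 * b ^+ 4.
  transitivity (b ^+ 8 * c ^+ 8 + (x * z) ^+ 2); first by ring2.
  by rewrite xz; ring2.
transitivity (a ^+ 4 * a^-1 ^+ 4 * (b ^+ 4 * (x * b ^+ 4 + z * c ^+ 4))).
  by ring2.
by rewrite -exprMn divff // expr1n mul1r.
Qed.

Lemma grade1_mod8_factor (E F : K) :
    E = x * a ^+ 16 + z * b ^+ 16 -> F = x * y ^+ 4 + z ^+ 5 ->
  E + F = a * (a * b ^+ 2 + c).
Proof. by move=> -> ->; rewrite -grade1_mod4_factor /x /y /z; ring2. Qed.

Lemma grade3_mod8_part (E F : K) :
    E = x * a ^+ 16 + z * b ^+ 16 -> F = x * y ^+ 4 + z ^+ 5 ->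
  (E + F) ^+ 2 * (c ^+ 16 * E + x ^+ 4 * F) * a^-1 ^+ 8 =
  (a * b ^+ 2 + c) ^+ 2 * b ^+ 8 * (x * c ^+ 8 + z * a ^+ 8) / a ^+ 6.
Proof.
move=> dE dF.
rewrite (grade1_mod8_factor dE dF).
(* Here x^4 F = x (xy)^4 + z (xz)^4, and the fourth powers of [xy] and [xz] reproduce c^16 E, which
   cancels. *)
have -> : c ^+ 16 * E + x ^+ 4 * F = b ^+ 8 * (x * c ^+ 8 + z * a ^+ 8).
  transitivity (c ^+ 16 * E + x * (x * y) ^+ 4 + z * (x * z) ^+ 4).
    by rewrite dF; ring2.
  by rewrite xz xy dE; ring2.
have <- : a ^+ 2 * a^-1 ^+ 8 = (a ^+ 6)^-1.
  by rewrite (exprD _ 2 6) mulrA -exprMn divff // expr1n mul1r exprVn.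
by ring2.
Qed.

Let h := b ^+ 3 + a * c ^+ 2 + a ^+ 3 * c.

(** By [xz], c^5 = a b^4 + a^2 b^2 + a c; by [yz], b^5 = b c + a^2 c^2 + a^4 c. On substitution the
    two terms a b c cancel, leaving a multiple of a^2. *)
Lemma mul_b_c5 : b * c ^+ 5 = a ^+ 2 * h.
Proof.
transitivity (a ^+ 2 * h + b * (x * z + (a ^+ 2 * b ^+ 2 + b ^+ 4 * c ^+ 4))
   + a * (y * z + (c ^+ 2 * a ^+ 2 + a ^+ 4 * b ^+ 4))).
  by rewrite /h /x /y /z; ring2.
by rewrite xz yz; ring2.
Qed.

(** This is the term of [grade3_mod8_part] not visibly divisible by a^6. The fourth power of [bc]
    splits b^8 c^8 into a^4 y^4 and b^4 c^16 = b c (b c^5)^3 = a^6 b c h^3. The first piece still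
    needs a factor a^2, found in y^4 x c^2. *)
Lemma grade3_mod8_remainder : b ^+ 8 * c ^+ 8 * x * (a * b ^+ 2 + c) ^+ 2 / a ^+ 6 =
  y ^+ 4 * x * b ^+ 4 + y ^+ 3 * c ^+ 6 * a ^+ 2
  + b ^+ 2 * c ^+ 4 * a ^+ 2 * (b ^+ 2 + a ^+ 4 * b + a ^+ 8)
  + h + c ^+ 6 + c ^+ 5 * a ^+ 2 + b * c * h ^+ 3 * x * (a * b ^+ 2 + c) ^+ 2.
Proof.
apply: (mulIf (expf_neq0 6 a0)); rewrite divfK ?expf_neq0 //.
have bc : b ^+ 2 * c ^+ 2 = a * y + b * c ^+ 4.
  transitivity (a * y + b * c ^+ 4 + (x * y + (b ^+ 2 * c ^+ 2 + c ^+ 4 * a ^+ 4))).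
    by rewrite /x /y; ring2.
  by rewrite xy; ring2.
have b5 : b ^+ 5 = c * b + c ^+ 2 * a ^+ 2 + c * a ^+ 4.
  transitivity (c * b + c ^+ 2 * a ^+ 2 + c * a ^+ 4
                + (y * z + (c ^+ 2 * a ^+ 2 + a ^+ 4 * b ^+ 4))).
    by rewrite /y /z; ring2.
  by rewrite yz; ring2.
have -> : b ^+ 8 * c ^+ 8 = a ^+ 4 * y ^+ 4 + b ^+ 4 * c ^+ 16.
  by transitivity ((b ^+ 2 * c ^+ 2) ^+ 4); [ring2 | rewrite bc; ring2].
have -> : b ^+ 4 * c ^+ 16 = a ^+ 6 * (b * c * h ^+ 3).
  by transitivity (b * c * (b * c ^+ 5) ^+ 3); [ring2 | rewrite mul_b_c5; ring2].
(* After [xy] and expansion of y^3, the one term without a visible factor a^2 is b^5 c^4; [b5]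
   reduces it to b c^5 plus multiples of a^2, and [mul_b_c5] finishes. *)
have yxc : y ^+ 4 * x * c ^+ 2 = a ^+ 2 * (y ^+ 3 * c ^+ 6 * a ^+ 2
  + b ^+ 2 * c ^+ 4 * a ^+ 2 * (b ^+ 2 + a ^+ 4 * b + a ^+ 8)
  + h + c ^+ 6 + c ^+ 5 * a ^+ 2).
  transitivity (y ^+ 3 * c ^+ 6 * a ^+ 4 + b ^+ 5 * c ^+ 4 +
     b ^+ 2 * c ^+ 4 * a ^+ 4 * (b ^+ 2 + a ^+ 4 * b + a ^+ 8)).
    transitivity (y ^+ 3 * (x * y) * c ^+ 2); first by ring2.
    by rewrite xy /y; ring2.
  transitivity (a ^+ 2 * h + c ^+ 5 * b + b ^+ 5 * c ^+ 4
    + (c * b + c ^+ 2 * a ^+ 2 + c * a ^+ 4) * c ^+ 4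
    + a ^+ 2 * (y ^+ 3 * c ^+ 6 * a ^+ 2
      + b ^+ 2 * c ^+ 4 * a ^+ 2 * (b ^+ 2 + a ^+ 4 * b + a ^+ 8)
      + h + c ^+ 6 + c ^+ 5 * a ^+ 2)).
    by ring2.
  by rewrite b5 -mul_b_c5; ring2.
transitivity (a ^+ 6 * (y ^+ 4 * x * b ^+ 4) + a ^+ 4 * (y ^+ 4 * x * c ^+ 2)
   + a ^+ 6 * (b * c * h ^+ 3 * x * (a * b ^+ 2 + c) ^+ 2)).
  by ring2.
by rewrite yxc; ring2.
Qed.

Lemma grade3_mod8_integral :
  (a * b ^+ 2 + c) ^+ 2 * b ^+ 8 * (x * c ^+ 8 + z * a ^+ 8) / a ^+ 6 =
  y ^+ 4 * x * b ^+ 4 + y ^+ 3 * c ^+ 6 * a ^+ 2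
  + b ^+ 2 * c ^+ 4 * a ^+ 2 * (b ^+ 2 + a ^+ 4 * b + a ^+ 8)
  + h + c ^+ 6 + c ^+ 5 * a ^+ 2 + b * c * h ^+ 3 * x * (a * b ^+ 2 + c) ^+ 2
  + (a * b ^+ 2 + c) ^+ 2 * b ^+ 8 * z * a ^+ 2.
Proof.
rewrite -grade3_mod8_remainder.
transitivity (b ^+ 8 * c ^+ 8 * x * (a * b ^+ 2 + c) ^+ 2 / a ^+ 6
  + (a * b ^+ 2 + c) ^+ 2 * b ^+ 8 * z * a ^+ 2 * (a ^+ 6 / a ^+ 6)).
  by ring2.
by rewrite divff ?expf_neq0 // mulr1.
Qed.

End CharacteristicTwo.

(** * Generating series modulo 2 *)

Lemma laurentME (F : fieldType) (f g : laurent F) (n : int) :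
  (f * g) n = \sum_(i \in [set: int]) f i * g (n - i).
Proof. by []. Qed.

Lemma F2_sqr (u : 'F_2) : u ^+ 2 = u.
Proof. by apply: val_inj; case: u => [[|[]]]. Qed.

Lemma laurent_pchar2 : 2%N \in [pchar laurent 'F_2].
Proof.
apply/andP; split=> //; apply/eqP/laurent_eqP => n /=.
by apply: val_inj; case: eqP.
Qed.

Lemma poly_sqr_coef (p : {poly 'F_2}) k :
  (p ^+ 2)`_k = if odd k then 0 else p`_(k./2).
Proof.
elim/poly_ind: p k => [|p u IHp] k.
  by rewrite expr0n /= !coef0 if_same.
have -> : (p * 'X + u%:P) ^+ 2 = p ^+ 2 * 'X * 'X + u%:P.
  rewrite sqrrD -mulr_natl (_ : 2%:R = 0 :> {poly 'F_2}) ?mul0r ?addr0.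
    by rewrite exprMn -polyC_exp F2_sqr mulrA.
  by rewrite -polyC_natr; apply/eqP; rewrite polyC_eq0.
rewrite !coefD !coefMX !coefC.
by case: k => [|[|k]] //=; rewrite ?addr0 ?IHp ?negbK.
Qed.

Lemma laurent_sqrE (f : laurent 'F_2) (n : int) :
  (f ^+ 2) n = if (2 %| n)%Z then f (n %/ 2)%Z else 0.
Proof.
have [N [u fE]] := laurentE f.
have -> : (f ^+ 2) n = lmul_coef f f n by [].
rewrite fE lmul_shift /shift_series; case: ltP => nN.
  by case: ifP => // n2; rewrite ifT //; lia.
set k := `|_|%N; rewrite (@conv_trunc _ k.+1) // -[_ * _]/(_ ^+ 2) poly_sqr_coef.
have -> : (2 %| n)%Z = ~~ odd k by lia.
case: ifP => //= ek; rewrite coef_poly ifT ?ifF; try lia.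
by congr u; lia.
Qed.

Section GeneratingSeries.
Variable I : choiceType.
Implicit Types (Q : I -> nat) (A B : set I).

Lemma gen_bounded Q A : exists N : int, forall k : int, k < N ->
  (fun k : int => \sum_(v \in A `&` [set v | (Q v)%:Z = k]) (1 : 'F_2)) k = 0.
Proof.
exists 0 => k k0; apply: fsbig1 => v [_ /= vk].
by rewrite -vk in k0.
Qed.
(** With an abstract index set, products of series become products of sets and substitutions become
    bijections. Sums over infinite fibers default to 0, whence [finitary] below. *)
Definition gen Q A : laurent 'F_2 := Laurent (gen_bounded Q A).

Definition finitary Q := forall k, finite_set [set v | (Q v <= k)%N].

Lemma finitary_fiber Q A (k : int) : finitary Q ->
  finite_set (A `&` [set v | (Q v)%:Z = k]).
Proof.
move=> Qfin; apply: sub_finite_set (Qfin `|k|%N) => v [_ /= <-].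
by rewrite absz_nat.
Qed.

Lemma gen_split Q A B : finitary Q -> gen Q A = gen Q (A `&` B) + gen Q (A `&` ~` B).
Proof.
move=> Qfin; apply: laurent_eqP => k /=.
rewrite (fsbigID B); last exact: finitary_fiber.
by congr (_ + _); rewrite setIAC.
Qed.

Lemma gen_sqr Q A : gen Q A ^+ 2 = gen (fun v => 2 * Q v)%N A.
Proof.
apply: laurent_eqP => k; rewrite laurent_sqrE /=; case: ifPn => k2.
  by apply: eq_fsbigl; rewrite eqEsubset; split => v [Av /= vk]; split=> //=; lia.
by rewrite fsbig1 // => v [_ /= vk]; case/negP: k2; lia.
Qed.

End GeneratingSeries.

Lemma gen_reindex (I J : choiceType) (h : I -> J) (Q : I -> nat) (R : J -> nat)
    (A : set I) (B : set J) :
  set_bij A B h -> (forall v, A v -> R (h v) = Q v) -> gen R B = gen Q A.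
Proof.
move=> [hAB hinj hsurj] RQ; apply: laurent_eqP => k /=.
apply: reindex_fsbig; split.
- by move=> v [Av /= <-]; split; [exact: hAB | rewrite /= RQ].
- by move=> v w /set_mem[Av _] /set_mem[Aw _]; apply: hinj; exact/mem_set.
- move=> w [/hsurj[v Av <-] /= vk]; exists v => //; split=> //=.
  by rewrite -RQ.
Qed.

Lemma fsbig_fiber (R : nmodType) (I J : choiceType) (h : I -> J) (D : set I) (F : I -> R) :
  finite_set D ->
  \sum_(j \in [set: J]) \sum_(i \in D `&` [set i | h i = j]) F i = \sum_(i \in D) F i.
Proof.
move=> Dfin.
transitivity (\sum_(j \in h @` D) \sum_(i \in D `&` [set i | h i = j]) F i).
  symmetry; apply: fsbig_widen => // j [_ hj] /=.
  by apply: fsbig1 => i [Di /= hi]; case: hj; exists i.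
under eq_fsbigr do rewrite fsbig_mkcondr.
rewrite exchange_fsbig //; last exact: finite_image.
apply: eq_fsbigr => i /set_mem Di.
transitivity (\sum_(j \in h @` D `&` [set h i]) F i).
  rewrite fsbig_mkcondr; apply: eq_fsbigr => j _; congr (if _ then _ else _).
  by apply/idP/idP => /set_mem /= hij; apply/mem_set.
rewrite (_ : _ `&` _ = [set h i]) ?fsbig_set1 //.
by apply/setIidr => _ ->; exists i.
Qed.

Lemma finitary_pair (I J : choiceType) (Q : I -> nat) (R : J -> nat) :
  finitary Q -> finitary R -> finitary (fun p => Q p.1 + R p.2)%N.
Proof.
move=> Qf Rf k; apply: sub_finite_set (finite_setX (Qf k) (Rf k)) => -[v w] /= vw.
by split => /=; lia.
Qed.

Lemma gen_mul (I J : choiceType) (Q : I -> nat) (R : J -> nat)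
    (A : set I) (B : set J) : finitary Q -> finitary R ->
  gen Q A * gen R B = gen (fun p => Q p.1 + R p.2)%N (A `*` B).
Proof.
move=> Qf Rf; apply: laurent_eqP => k; rewrite laurentME /=.
(* Pairs are grouped by the exponent of the first factor, to match the convolution. *)
rewrite -(@fsbig_fiber _ _ _ (fun p => (Q p.1)%:Z)); last first.
  exact/finitary_fiber/finitary_pair.
apply: eq_fsbigr => i _; rewrite mulr_fsuml; under eq_fsbigr do rewrite mul1r.
rewrite pair_fsbig; [|exact: finitary_fiber..].
apply: eq_fsbigl; rewrite eqEsubset; split => -[v w] /=.
  by move=> [[Av /= vi] [Bw /= wk]]; split; [split=> //=; lia|].
by move=> [[[Av Bw] /= vwk] /= vi]; split; split=> //=; lia.
Qed.

Lemma finitary_sqr : finitary (fun n : int => `|n| ^ 2)%N.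
Proof.
move=> k; apply: (@sub_finite_set _ _ ((fun i : nat => i%:Z - k%:Z) @` `I_k.*2.+1)).
  by move=> n /= nk; exists (absz (n + k%:Z)) => /=; nia.
exact/finite_image/finite_II.
Qed.

(** * The theta series of level 7 *)

Definition sqn (n : int) : nat := (`|n| ^ 2)%N.

Lemma sqnE n : (sqn n)%:Z = n * n.
Proof. by rewrite /sqn; nia. Qed.

Definition residue7 (i : int) : set int := [set n | (n = i %[mod 7])%Z].
Definition even_int : set int := [set n | ~~ odd `|n|].

Lemma theta_gen i : theta 7 i = gen sqn (residue7 i).
Proof.
apply: laurent_eqP => k /=; apply: eq_fsbigl.
by rewrite eqEsubset /residue7 /sqn; split => n /= [ni nk]; split => //=; nia.
Qed.

Lemma theta_mod i j : (i = j %[mod 7])%Z -> theta 7 i = theta 7 j.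
Proof. by move=> ij; rewrite !theta_gen /residue7 ij. Qed.

Lemma theta_opp i : theta 7 (- i) = theta 7 i.
Proof.
rewrite !theta_gen; apply: (@gen_reindex _ _ (@GRing.opp int)).
  split=> [n|n m _ _ /oppr_inj //|n]; rewrite /residue7 /=; first by lia.
  by move=> ni; exists (- n); rewrite /= ?opprK //; lia.
by move=> n _; rewrite /sqn abszN.
Qed.

Definition odd_theta (i : int) : laurent 'F_2 := gen sqn (residue7 i `&` ~` even_int).

(** Put n = 2m: then m = 4i mod 7, as 4 inverts 2, and n^2 = 4m^2, while a fourth power multiplies
    exponents by 4. *)
Lemma theta_even i : gen sqn (residue7 i `&` even_int) = theta 7 (4 * i) ^+ 4.
Proof.
rewrite (exprM _ 2 2) theta_gen !gen_sqr.
apply: (@gen_reindex _ _ (fun n : int => 2 * n)).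
  rewrite /residue7 /even_int; split=> [n /= ni|n m _ _ /= nm|n /= [ni n2]].
  - by split; lia.
  - by lia.
  - by exists (n %/ 2)%Z; lia.
by move=> n _; rewrite /sqn; nia.
Qed.

Lemma theta_split i : theta 7 i = theta 7 (4 * i) ^+ 4 + odd_theta i.
Proof. by rewrite -theta_even theta_gen -gen_split //; exact: finitary_sqr. Qed.

Lemma theta_product i j :
  theta 7 i ^+ 2 * theta 7 j ^+ 2 =
  odd_theta (i + j) * odd_theta (i - j)
  + theta 7 (4 * (i + j)) ^+ 4 * theta 7 (4 * (i - j)) ^+ 4.
Proof.
have sqf := finitary_sqr; have pf := finitary_pair sqf sqf.
(* [D] is the image of the index set of [theta 7 i * theta 7 j] under
   [(m, n) -> (m + n, m - n)], which doubles the sum of squares. *)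
rewrite -!theta_even /odd_theta -exprMn !theta_gen !gen_mul // gen_sqr.
pose D : set (int * int) := [set p | [/\ residue7 (i + j) p.1, residue7 (i - j) p.2
  & odd `|p.1| = odd `|p.2|]].
transitivity (gen (fun p => sqn p.1 + sqn p.2)%N D).
  symmetry; apply: (@gen_reindex _ _ (fun p : int * int => (p.1 + p.2, p.1 - p.2))).
    rewrite /D /residue7; split=> [[n m] [/= ni mj]|[n m] [n' m'] _ _ [/= e1 e2]
      |[s t] /= [si tj st]].
    - by split=> /=; lia.
    - by congr pair; lia.
    - have [u su] : exists u, s + t = 2 * u by exists ((s + t) %/ 2)%Z; lia.
      by exists (u, s - u) => /=; [split=> /=; lia | congr pair; lia].
  move=> [n m] _ /=; have := sqnE (n + m); have := sqnE (n - m).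
  by have := sqnE n; have := sqnE m; nia.
(* The entries of a pair in [D] have equal parity: both odd gives the first product, both even the
   second. *)
rewrite (gen_split D [set p | even_int p.1] pf) [LHS]addrC; congr (_ + _);
  apply: (congr1 (gen _)); rewrite eqEsubset /D /residue7 /even_int; split => -[s t] /=.
- by move=> [[si tj st] s2]; split; split=> //; lia.
- by move=> [[si s2] [tj t2]]; split; [split=> //|]; lia.
- by move=> [[si tj st] s2]; split; split=> //; lia.
- by move=> [[si s2] [tj t2]]; split; [split=> //|]; lia.
Qed.

(** * Exponents modulo q *)

Definition graded (q j : nat) (f : laurent 'F_2) : Prop :=
  forall n : int, f n != 0 -> (n = j%:Z %[mod q%:Z])%Z.

Lemma graded_mod q j k f : graded q j f -> j = k %[mod q] -> graded q k f.
Proof. by move=> fj jk n /fj ->; rewrite !modz_nat jk. Qed.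

Lemma graded_dvd q m j f : (m %| q)%N -> graded q j f -> graded m j f.
Proof.
move=> mq fj n /fj /eqP; rewrite eqz_mod_dvd => qn; apply/eqP.
by rewrite eqz_mod_dvd; apply: dvdz_trans qn.
Qed.

Lemma graded1 f : graded 1 0 f.
Proof. by move=> n _; rewrite !modz1. Qed.

Lemma gradedD q j f g : graded q j f -> graded q j g -> graded q j (f + g).
Proof.
move=> fj gj n /=; have [f0|/fj //] := eqVneq (f n) 0.
by rewrite f0 add0r => /gj.
Qed.

Lemma fsum_neq0 (V : nmodType) (I : choiceType) (P : set I) (F : I -> V) :
  \sum_(i \in P) F i != 0 -> exists2 i, P i & F i != 0.
Proof. exact: (@fsbigN1 _ _ _ unit _ P (fun=> F) tt). Qed.

Lemma gradedM q j k f g : graded q j f -> graded q k g -> graded q (j + k) (f * g).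
Proof.
move=> fj gk n; rewrite laurentME => /fsum_neq0[i _]; rewrite mulf_eq0 negb_or.
by move=> /andP[/fj fi /gk gi]; rewrite -[n in LHS](subrKC i) -modzDm fi gi modzDm -PoszD.
Qed.

Lemma gradedX q j f n : graded q j f -> graded q (j * n) (f ^+ n).
Proof.
move=> fj; elim: n => [|n IHn]; last by rewrite exprS mulnS; exact: gradedM.
by rewrite expr0 muln0 => k /=; have [->|] := eqVneq k 0; rewrite ?eqxx.
Qed.

Lemma graded_sqr q j f : graded q j f -> graded (2 * q) (2 * j) (f ^+ 2).
Proof.
move=> fj n; rewrite laurent_sqrE; case: ifP => [/dvdzP[m ->]|_]; last by rewrite eqxx.
rewrite mulzK // => /fj /eqP; rewrite eqz_mod_dvd => mj; apply/eqP.
by rewrite eqz_mod_dvd !PoszM mulrC -mulrBr dvdz_mul2l.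
Qed.

Lemma graded_exp4 q j f : graded q j f -> graded (4 * q) (4 * j) (f ^+ 4).
Proof.
by move=> fj; rewrite (exprM _ 2 2) -(mulnA 2 2) -(mulnA 2 2); do 2 apply: graded_sqr.
Qed.

Lemma lprojD q j (f g : laurent 'F_2) : lproj q j (f + g) = lproj q j f + lproj q j g.
Proof. by apply: laurent_eqP => n /=; case: ifP; rewrite ?addr0. Qed.

Lemma lproj_graded q j f : graded q j f -> lproj q j f = f.
Proof.
move=> fj; apply: laurent_eqP => n /=; case: ifP => // /eqP nj.
by apply/esym/eqP; apply: contraT => /fj.
Qed.

(** The divisor m allows terms whose grade is known only to a coarser modulus to be discarded. *)
Lemma lproj_off q j m k f : (m %| q)%N -> (j != k %[mod m])%N -> graded m k f ->
  lproj q j f = 0.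
Proof.
move=> mq jk fk; apply: laurent_eqP => n /=; case: ifP => // /eqP nj.
apply/eqP; apply: contraNT jk => /fk nk; rewrite -eqz_nat -!modz_nat -nk eq_sym.
by rewrite eqz_mod_dvd; apply: dvdz_trans (_ : (q %| _)%Z) => //; rewrite -eqz_mod_dvd nj.
Qed.

Lemma odd_theta_graded i : graded 8 1 (odd_theta i).
Proof.
move=> n /fsum_neq0[m [[_ mo] /= <-] _].
move/negP: mo; rewrite negbK /sqn => mo; have [k ->] : exists k, m = 2 * k + 1.
  by exists (m %/ 2)%Z; lia.
(* As k(k + 1) is even, m^2 = 4k(k + 1) + 1 is 1 mod 8. *)
have [l kl] : exists l, k * (k + 1) = 2 * l.
  have [u [->|->]] : exists u, k = 2 * u \/ k = 2 * u + 1 by exists (k %/ 2)%Z; lia.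
    by exists (u * (2 * u + 1)); lia.
  by exists ((2 * u + 1) * (u + 1)); lia.
by rewrite sqnE; apply/eqP; rewrite eqz_mod_dvd; apply/dvdzP; exists l; lia.
Qed.

Lemma odd_thetaE i : odd_theta i = theta 7 i + theta 7 (4 * i) ^+ 4.
Proof. by rewrite [theta 7 i]theta_split addrAC (addrr_pchar2 laurent_pchar2) add0r. Qed.

Lemma theta_relation i j :
  (theta 7 (i + j) + theta 7 (4 * (i + j)) ^+ 4)
    * (theta 7 (i - j) + theta 7 (4 * (i - j)) ^+ 4) =
  theta 7 i ^+ 2 * theta 7 j ^+ 2
  + theta 7 (4 * (i + j)) ^+ 4 * theta 7 (4 * (i - j)) ^+ 4.
Proof.
by rewrite theta_product !odd_thetaE -addrA (addrr_pchar2 laurent_pchar2) addr0.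
Qed.

Lemma theta_cong i j : (i = j %[mod 7])%Z \/ (i = - j %[mod 7])%Z -> theta 7 i = theta 7 j.
Proof. by case=> [/theta_mod //|/theta_mod ->]; exact: theta_opp. Qed.

(** Doubling has order 3 modulo 7 and [theta] is even in its index, so sums and differences of i,
    2i, 4i lead back to a, b, c: for instance i + 2i = -4i and i - 2i = -i mod 7. *)
Lemma theta_cycle i (a := theta 7 i) (b := theta 7 (2 * i)) (c := theta 7 (4 * i)) :
  [/\ graded 8 1 (a + c ^+ 4), graded 8 1 (b + a ^+ 4) & graded 8 1 (c + b ^+ 4)]
  /\ [/\ (a + c ^+ 4) * (c + b ^+ 4) = a ^+ 2 * b ^+ 2 + b ^+ 4 * c ^+ 4,
         (a + c ^+ 4) * (b + a ^+ 4) = b ^+ 2 * c ^+ 2 + c ^+ 4 * a ^+ 4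
       & (b + a ^+ 4) * (c + b ^+ 4) = c ^+ 2 * a ^+ 2 + a ^+ 4 * b ^+ 4].
Proof.
have aE k : (k = i %[mod 7])%Z \/ (k = - i %[mod 7])%Z -> theta 7 k = a by exact: theta_cong.
have bE k : (k = 2 * i %[mod 7])%Z \/ (k = - (2 * i) %[mod 7])%Z -> theta 7 k = b.
  exact: theta_cong.
have cE k : (k = 4 * i %[mod 7])%Z \/ (k = - (4 * i) %[mod 7])%Z -> theta 7 k = c.
  exact: theta_cong.
split; split.
- by have := @odd_theta_graded i; rewrite odd_thetaE.
- by have := @odd_theta_graded (2 * i); rewrite odd_thetaE (aE (4 * _)); [|lia].
- by have := @odd_theta_graded (4 * i); rewrite odd_thetaE (bE (4 * (4 * i))); [|lia].
- have := theta_relation i (2 * i).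
  rewrite (cE (i + 2 * i)) ?(bE (4 * (i + 2 * i))) ?(aE (i - 2 * i)) ?(cE (4 * (i - 2 * i)));
    try lia.
  by rewrite mulrC => ->.
- have := theta_relation (2 * i) (4 * i).
  rewrite (aE (2 * i + 4 * i)) ?(cE (4 * (2 * i + 4 * i))) ?(bE (2 * i - 4 * i))
    ?(aE (4 * (2 * i - 4 * i))); by [|lia].
- have := theta_relation (4 * i) i.
  rewrite (bE (4 * i + i)) ?(aE (4 * (4 * i + i))) ?(cE (4 * i - i)) ?(bE (4 * (4 * i - i)));
    by [|lia].
Qed.

Lemma graded_frobenius k f : graded (2 ^ k) 0 (f ^+ (2 ^ k)).
Proof.
elim: k => [|k IHk]; first exact: graded1.
by rewrite expnS [in f ^+ _]mulnC exprM; exact: (graded_sqr IHk).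
Qed.

(** * The ring generated by the theta series *)

Lemma theta_ring1 : theta_ring 1.
Proof. by move=> A [[A1 _ _] _]; exact/set_mem. Qed.

Lemma theta_ringB f g : theta_ring f -> theta_ring g -> theta_ring (f - g).
Proof.
move=> Sf Sg A AG; have [[_ AB _] _] := AG.
by apply/set_mem/AB; apply/mem_set; [exact: Sf | exact: Sg].
Qed.

Lemma theta_ringM f g : theta_ring f -> theta_ring g -> theta_ring (f * g).
Proof.
move=> Sf Sg A AG; have [[_ _ AM] _] := AG.
by apply/set_mem/AM; apply/mem_set; [exact: Sf | exact: Sg].
Qed.

Lemma theta_ring0 : theta_ring 0.
Proof. by rewrite -(subrr 1); apply: theta_ringB; exact: theta_ring1. Qed.

Lemma theta_ringD f g : theta_ring f -> theta_ring g -> theta_ring (f + g).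
Proof.
move=> Sf Sg; rewrite -[g]opprK -[- g]add0r.
by apply: theta_ringB Sf _; apply: theta_ringB Sg; exact: theta_ring0.
Qed.

Lemma theta_ringX f n : theta_ring f -> theta_ring (f ^+ n).
Proof.
move=> Sf; elim: n => [|n IHn]; first exact: theta_ring1.
by rewrite exprS; exact: theta_ringM.
Qed.

Lemma theta_ring_theta i : ~~ (7 %| i)%Z -> theta_ring (theta 7 i).
Proof.
move=> i7; have [k k0 ->] : exists2 k : int, k \in [:: 1; 2; 3] & theta 7 i = theta 7 k.
  have [k k0 ik] : exists2 k : int, k \in [:: 1; 2; 3] &
      (i = k %[mod 7])%Z \/ (i = - k %[mod 7])%Z.
    have : [|| (i %% 7 == 1)%Z, (i %% 7 == 2)%Z, (i %% 7 == 3)%Z, (i %% 7 == 4)%Z,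
       (i %% 7 == 5)%Z | (i %% 7 == 6)%Z] by lia.
    by case/or3P=> [?|?|/or4P[] ?]; [exists 1|exists 2|exists 3|exists 3|exists 2|exists 1];
      rewrite // ; lia.
  by exists k => //; exact: theta_cong.
apply: sub_gen_smallest; move: k0; rewrite !inE => /or3P[] /eqP ->.
- by left; left.
- by left; right.
- by right.
Qed.

(** The grade is first inferred from the factors, then compared with the expected one modulo q. *)
Ltac grade_monomial := apply: graded_mod;
  [repeat match goal with
   | H : graded ?q _ ?f |- graded ?q _ ?f => exact H
   | |- graded _ _ (_ ^+ _) => eapply gradedX
   | |- graded _ _ (_ * _) => eapply gradedM
   end | by []].
Ltac grade := repeat apply: gradedD; grade_monomial.
Ltac in_theta_ring := repeat first
  [assumption | apply: theta_ringM | apply: theta_ringD | apply: theta_ringX].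

(** * The two projections of 1/a *)

Lemma lproj_invr_theta i (a := theta 7 i) : ~~ (7 %| i)%Z -> a != 0 ->
  theta_ring (lproj 16 4 a^-1) /\ theta_ring (lproj 32 12 a^-1).
Proof.
move=> i7 a0; have char2 := laurent_pchar2; have [[gx gy gz] [xz xy yz]] := theta_cycle i.
move: (theta_ring_theta i7) (@theta_ring_theta (2 * i)) (@theta_ring_theta (4 * i)).
(* From here on only the grades, the three relations and membership in the ring are kept of the
   theta series. *)
move: (theta 7 (2 * i)) (theta 7 (4 * i)) gx gy gz xz xy yz => b c.
rewrite -/a; move: a a0 => {}a a0.
set x := a + c ^+ 4; set y := b + a ^+ 4; set z := c + b ^+ 4.
move=> gx gy gz xz xy yz Sa /(_ ltac:(lia)) Sb /(_ ltac:(lia)) Sc.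
have Sx : theta_ring x by rewrite /x; in_theta_ring.
have Sy : theta_ring y by rewrite /y; in_theta_ring.
have Sz : theta_ring z by rewrite /z; in_theta_ring.
have gx4 : graded 4 1 x by exact: graded_dvd gx.
have gz4 : graded 4 1 z by exact: graded_dvd gz.
have gb4 : graded 4 0 (b ^+ 4) by exact: (@graded_frobenius 2).
have gc4 : graded 4 0 (c ^+ 4) by exact: (@graded_frobenius 2).
have gv4 : graded 4 0 (a^-1 ^+ 4) by exact: (@graded_frobenius 2).
have gv8 : graded 8 0 (a^-1 ^+ 8) by exact: (@graded_frobenius 3).
have ga16 : graded 8 0 (a ^+ 16) by apply: graded_dvd (@graded_frobenius 4 a).
have gb16 : graded 8 0 (b ^+ 16) by apply: graded_dvd (@graded_frobenius 4 b).
have gc16 : graded 8 0 (c ^+ 16) by apply: graded_dvd (@graded_frobenius 4 c).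
(* The parts of [L] below of grade 1 and 5 mod 8, as [b ^+ 4 = a ^+ 16 + y ^+ 4]
   and [c ^+ 4 = b ^+ 16 + z ^+ 4]. *)
pose E := x * a ^+ 16 + z * b ^+ 16.
pose F := x * y ^+ 4 + z ^+ 5.
have gE : graded 8 1 E by rewrite /E; grade.
have gF : graded 8 5 F by rewrite /F; grade.
have gEF : graded 8 2 ((E + F) ^+ 2).
  (* The grades 1 and 5 agree mod 4, and squaring doubles the modulus. *)
  apply: (@graded_sqr 4 1); apply: gradedD; first exact: graded_dvd gE.
  by apply: graded_mod (graded_dvd _ gF) _.
pose P1 := x * (c ^+ 4) ^+ 2 * a^-1 ^+ 4.
pose P2 := x ^+ 2 * c ^+ 4 * a^-1 ^+ 4.
pose P3 := x ^+ 3 * a^-1 ^+ 4.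
have gP1 : graded 4 1 P1 by rewrite /P1; grade.
have gP2 : graded 4 2 P2 by rewrite /P2; grade.
have gP3 : graded 4 3 P3 by rewrite /P3; grade.
pose L := x * b ^+ 4 + z * c ^+ 4.
have gL : graded 4 1 L by rewrite /L; grade.
have LEF : L = E + F.
  rewrite (grade1_mod8_factor char2 xz (erefl E) (erefl F)).
  exact: (grade1_mod4_factor char2 xz).
have := cube_div_split_mod4 char2 b c a0.
rewrite (grade1_mod4_part char2 a0 xz) -/x -/z -/L.
(* These are the parts of c^3/a of grades 0, 1, 2 mod 4; the part of grade 3 is refined into [H3]
   and [H7], named by their grades mod 8. *)
set G0 := _ * a^-1 ^+ 4; set G1 := b ^+ 4 * L; set G2 := (_ + x ^+ 3 * z ^+ 3) * _.
pose H3 := (E + F) ^+ 2 * (c ^+ 16 * E + x ^+ 4 * F) * a^-1 ^+ 8.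
pose H7 := (E + F) ^+ 2 * (c ^+ 16 * F + x ^+ 4 * E) * a^-1 ^+ 8.
have LE : L ^+ 3 * a^-1 ^+ 4 = H3 + H7 by rewrite LEF; exact: grade3_split_mod8.
rewrite LE => cE.
have gG0 : graded 4 0 G0 by apply: (@gradedM 4 0 0) gv4; grade.
have gG1 : graded 4 1 G1 by exact: (@gradedM 4 0 1).
have gG2 : graded 4 2 G2 by apply: (@gradedM 4 2 0) gv4; grade.
have gH3 : graded 8 3 H3.
  by apply: (@gradedM 8 3 0) gv8; apply: (@gradedM 8 2 1) gEF _; grade.
have gH7 : graded 8 7 H7.
  by apply: (@gradedM 8 7 0) gv8; apply: (@gradedM 8 2 5) gEF _; grade.
have SG1 : theta_ring G1 by rewrite /G1 /L; in_theta_ring.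
have SH3 : theta_ring H3.
  rewrite /H3 (grade3_mod8_part char2 a0 xz xy (erefl E) (erefl F)).
  rewrite (grade3_mod8_integral char2 a0 xz xy yz); in_theta_ring.
have -> : a^-1 = P3 + P2 + P1 + (G0 ^+ 4 + G1 ^+ 4 + G2 ^+ 4 + (H3 ^+ 4 + H7 ^+ 4)).
  by rewrite [LHS](invr_split_mod4 char2 c a0) cE !(exprD4 char2) -/x 2!mulrDl.
have gG0' := graded_exp4 gG0; have gG1' := graded_exp4 gG1; have gG2' := graded_exp4 gG2.
have gH3' := graded_exp4 gH3; have gH7' := graded_exp4 gH7.
rewrite !lprojD; split.
  (* Only [G1 ^+ 4] survives: [H3 ^+ 4] and [H7 ^+ 4] both have grade 12 mod 16. *)
  rewrite (lproj_off _ _ gP1) // (lproj_off _ _ gP2) // (lproj_off _ _ gP3) //.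
  rewrite (lproj_off _ _ gG0') // (lproj_off _ _ gG2') //.
  rewrite (lproj_off _ _ (graded_dvd (isT : 16 %| 4 * 8)%N gH3')) //.
  rewrite (lproj_off _ _ (graded_dvd (isT : 16 %| 4 * 8)%N gH7')) //.
  by rewrite (lproj_graded gG1') !(addr0, add0r); exact: theta_ringX.
(* Modulo 32 the grades 12 of [H3 ^+ 4] and 28 of [H7 ^+ 4] are separated. *)
rewrite (lproj_off _ _ gP1) // (lproj_off _ _ gP2) // (lproj_off _ _ gP3) //.
rewrite (lproj_off _ _ gG0') // (lproj_off _ _ gG1') // (lproj_off _ _ gG2') //.
rewrite (lproj_off _ _ gH7') // (lproj_graded gH3') !(addr0, add0r).
exact: theta_ringX.
Qed.

Theorem theorem5p4 (r : nat) (hr : (1 <= r <= 3)%N) :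
  let a := theta 7 r in
  theta_ring (lproj 16 4 (1 / a)) /\ theta_ring (lproj 32 12 (1 / a)).
Proof.
(* [theta 7 r] is nonzero, but [1 / 0 = 0] makes this case free. *)
move=> a; rewrite div1r; have [->|a0] := eqVneq a 0; last first.
  by apply: lproj_invr_theta a0; lia.
have lproj0 q j : lproj q j (0 : laurent 'F_2) = 0.
  by apply: laurent_eqP => n /=; case: ifP.
by rewrite invr0 !lproj0; split; exact: theta_ring0.
Qed.
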